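(* Let $P\in C_0\cap C_j$ for some $j\ge 1$. Then $$\{f_1,f_2,f_3\}_{C_0,P}=(f_1,f_2,f_3)^{x_0}_{C_0,P}\cdot(f_2,f_3,f_1)^{x_0}_{C_0,P}\cdot(f_3,f_1,f_2)^{x_0}_{C_0,P},$$ i.e. the Parshin symbol is the product of the refined symbols over the cyclic permutations of $f_1,f_2,f_3$.
   Context: Let $X$ be a smooth complex projective surface and let $f_1,f_2,f_3$ be non-zero rational functions on $X$. Let $C_0,\dots,C_r$ be the irreducible components of the divisors of $f_1,f_2,f_3$. Assume that every $C_i$ is non-singular and that the components have normal crossings (at an intersection point only two components meet, and they meet transversally). Put $n_{ki}=\mathrm{ord}_{C_i}f_k$ and $m_k=n_{k0}$. For each $i$ let $x_i$ be a rational function on $X$ with $\mathrm{ord}_{C_j}x_i=\delta_{ij}$ for all $j$ ($x_i$ may have other zeros and poles); the same $x_0$ is used at all points of $C_0$. For $P\in C_0\cap C_j$ with $j\ge 1$, put $n_k=n_{kj}$ and define $g_k$ by $f_k=x_0^{m_k}x_j^{n_k}g_k$ for $k=1,2,3$; the functions $x_0,x_j$ define $C_0,C_j$ near $P$, so that $g_k$ is well defined and non-zero at $P$. Parshin symbol: $\{f_1,f_2,f_3\}_{C_0,P}=(-1)^K g_1(P)^{D_1}g_2(P)^{D_2}g_3(P)^{D_3}$, where $D_1=m_2n_3-m_3n_2$, $D_2=m_3n_1-m_1n_3$, $D_3=m_1n_2-m_2n_1$ and $K=n_1n_2m_3+n_2n_3m_1+n_3n_1m_2-m_1m_2n_3-m_2m_3n_1-m_3m_1n_2$.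 Refined symbol: $(f_1,f_2,f_3)^{x_0}_{C_0,P}=(-1)^{n_1n_3m_2-m_1m_3n_2}\left(\dfrac{g_1(P)^{n_3}}{g_3(P)^{n_1}}\right)^{m_2}$. The symbols $(f_2,f_3,f_1)^{x_0}_{C_0,P}$ and $(f_3,f_1,f_2)^{x_0}_{C_0,P}$ are obtained by permuting the indices $1,2,3$ of $m_k,n_k,g_k$ accordingly. *)

(* Defs.v *)
From HB Require Import structures.
From mathcomp Require Import all_boot all_order all_algebra.
From mathcomp Require Import reals complex mpoly.
From Stdlib Require Import ClassicalEpsilon.

Set Implicit Arguments.
Unset Strict Implicit.
Unset Printing Implicit Defensive.

Import Order.TTheory GRing.Theory Num.Theory.
Local Open Scope ring_scope.

Section ProjectiveGeometry.
Variables (k : closedFieldType) (N : nat).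
Local Notation S := {mpoly k[N.+1]}.

(* An irreducible closed subset of P^N, given by its ideal: a homogeneous
   prime of the coordinate ring S other than the irrelevant one.  (S itself is
   excluded by the last field, since it contains the variables.) *)
Record homog_prime := HomogPrime {
  in_ideal :> S -> Prop;
  in_ideal0 : in_ideal 0;
  in_idealD : forall F G, in_ideal F -> in_ideal G -> in_ideal (F + G);
  in_idealM : forall F G, in_ideal G -> in_ideal (F * G);
  in_ideal_homog : forall d F, in_ideal F -> in_ideal (pihomog mdeg d F);
  in_ideal_prime : forall F G, in_ideal (F * G) -> in_ideal F \/ in_ideal G;
  in_ideal_relevant : exists i, ~ in_ideal 'X_i
}.

(* Inclusion of subsets reverses inclusion of ideals. *)
Definition closed_sub (Z W : homog_prime) := forall F, W F -> Z F.
Definition closed_eq (Z W : homog_prime) := closed_sub Z W /\ closed_sub W Z.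

(* Krull dimension, by chains of irreducible closed subsets. *)
Fixpoint dim_le (n : nat) (Z : homog_prime) : Prop :=
  forall W, closed_sub W Z -> ~ closed_sub Z W ->
  if n is n'.+1 then dim_le n' W else False.
Definition has_dim (Z : homog_prime) (n : nat) :=
  dim_le n Z /\ forall m, (m < n)%N -> ~ dim_le m Z.

(* A closed point of P^N, in homogeneous coordinates. *)
Record point := Point {
  coords :> 'I_N.+1 -> k;
  coords_neq0 : exists i, coords i != 0
}.

Definition vanish (P : point) : S -> Prop := fun F => F.@[P] = 0.
Definition lies_on (P : point) (Z : homog_prime) := forall F, Z F -> vanish P F.

(* A projective variety with its field of rational functions.  The function
   field is characterised as an extension K of k containing the homogeneous
   coordinates z of a generic point: the homogeneous relations between the z_i
   are exactly the equations of the variety, and K consists of the quotients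
   F(z)/G(z) of forms of the same degree.  For instance z_i = X_i/X_a, where
   X_a does not vanish identically on the variety. *)
Record variety := Variety {
  closed_of :> homog_prime;
  funfield : fieldType;
  const : {rmorphism k -> funfield};
  gen_coord : 'I_N.+1 -> funfield;
  gen_coordP : forall d (F : S), F \is d.-homog ->
    (mmap const gen_coord F = 0 <-> closed_of F);
  funfieldP : forall f : funfield, exists d (F G : S),
    [/\ F \is d.-homog, G \is d.-homog, ~ closed_of G
      & f = mmap const gen_coord F / mmap const gen_coord G]
}.

Section OnVariety.
Variable X : variety.
Local Notation K := (funfield X).
Local Notation "F ^gen" := (mmap (const X) (@gen_coord X) F)
  (at level 2, format "F ^gen").

(* Local algebra at a point x of the scheme X: [x] is either the ideal of an
   irreducible closed subset of X (its generic point) or [vanish P] for a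
   closed point P of X.  [local_ideal x J] is the ideal generated in the local
   ring O_{X,x} by the homogeneous ideal J. *)
Definition local_ideal (x J : S -> Prop) (f : K) := exists d (F G : S),
  [/\ F \is d.-homog, G \is d.-homog, J F, ~ x G & f = F^gen / G^gen].
Definition local_ring (x : S -> Prop) := local_ideal x (fun=> True).
Definition local_max (x : S -> Prop) := local_ideal x x.
Definition local_generator (x J : S -> Prop) (t : K) := forall f,
  local_ideal x J f <-> exists2 a, local_ring x a & f = a * t.

(* For a surface, every closed point has a local ring of dimension 2, so that
   it is regular if and only if two elements generate the maximal ideal. *)
Definition smooth_surface := has_dim X 2 /\
  forall P : point, lies_on P X -> exists u v : K, forall f,
    local_max (vanish P) f <->
    exists a b, [/\ local_ring (vanish P) a, local_ring (vanish P) b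
                  & f = a * u + b * v].

Record curve := Curve {
  curve_closed :> homog_prime;
  curve_sub : closed_sub curve_closed X;
  curve_dim : has_dim curve_closed 1
}.

(* The local ring O_{C,P} = O_{X,P} / I_{C,P} has principal maximal ideal. *)
Definition nonsingular (C : curve) := forall P : point, lies_on P C ->
  exists t : K, forall f, local_max (vanish P) f <->
    exists a b, [/\ local_ring (vanish P) a, local_ideal (vanish P) C b
                  & f = a * t + b].

(* The local equations of C and D together generate the maximal ideal. *)
Definition transversal (C D : curve) (P : point) := forall f,
  local_max (vanish P) f <->
  exists a b, [/\ local_ideal (vanish P) C a, local_ideal (vanish P) D b
                & f = a + b].

Definition normal_crossings (r : nat) (C : 'I_r.+1 -> curve) :=
  (forall i j l P, i != j -> j != l -> i != l ->
     ~ [/\ lies_on P (C i), lies_on P (C j) & lies_on P (C l)]) /\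
  (forall i j P, i != j -> lies_on P (C i) -> lies_on P (C j) ->
     transversal (C i) (C j) P).

(* The function x is a local equation of C at P. *)
Definition defines_near (C : curve) (P : point) (x : K) :=
  local_generator (vanish P) C x.

(* On a smooth surface, O_{X,C} is a discrete valuation ring: if f is non-zero
   then there is exactly one n such that [has_ord C f n].  There is none if
   f = 0, and then [ord C f] is an arbitrary integer. *)
Definition has_ord (C : curve) (f : K) (n : int) := exists t u,
  [/\ local_generator C C t, local_ring C u, ~ local_max C u & f = t ^ n * u].
Definition ord (C : curve) (f : K) : int :=
  epsilon (inhabits 0) (has_ord C f).

(* The value at P of a function g regular at P; it does not depend on the
   chosen fraction. *)
Definition has_value (g : K) (P : point) (c : k) := exists d (F G : S),
  [/\ F \is d.-homog, G \is d.-homog, ~ vanish P G, g = F^gen / G^gen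
    & c = F.@[P] / G.@[P]].
Definition value (g : K) (P : point) : k := epsilon (inhabits 0) (has_value g P).

(* C_0, ..., C_r are the distinct irreducible components of the divisors. *)
Definition divisor_components (f1 f2 f3 : K) (r : nat) (C : 'I_r.+1 -> curve) :=
  (forall i j, closed_eq (C i) (C j) -> i = j) /\
  (forall E : curve,
     (exists i, closed_eq E (C i)) <->
     [\/ ord E f1 != 0, ord E f2 != 0 | ord E f3 != 0]).

Section Symbols.
Variables (C0 Cj : curve) (x0 xj : K) (P : point).

(* The value at P of g, where f = x0^m xj^n g. *)
Definition gval (f : K) : k :=
  value (f / (x0 ^ ord C0 f * xj ^ ord Cj f)) P.

Definition parshin_symbol (f1 f2 f3 : K) : k :=
  let m1 := ord C0 f1 in let m2 := ord C0 f2 in let m3 := ord C0 f3 in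
  let n1 := ord Cj f1 in let n2 := ord Cj f2 in let n3 := ord Cj f3 in
  let D1 := m2 * n3 - m3 * n2 in
  let D2 := m3 * n1 - m1 * n3 in
  let D3 := m1 * n2 - m2 * n1 in
  let e := n1 * n2 * m3 + n2 * n3 * m1 + n3 * n1 * m2
           - m1 * m2 * n3 - m2 * m3 * n1 - m3 * m1 * n2 in
  (-1) ^ e * gval f1 ^ D1 * gval f2 ^ D2 * gval f3 ^ D3.

Definition refined_symbol (f1 f2 f3 : K) : k :=
  let m1 := ord C0 f1 in let m2 := ord C0 f2 in let m3 := ord C0 f3 in
  let n1 := ord Cj f1 in let n2 := ord Cj f2 in let n3 := ord Cj f3 in
  (-1) ^ (n1 * n3 * m2 - m1 * m3 * n2)
  * (gval f1 ^ n3 / gval f3 ^ n1) ^ m2.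

End Symbols.
End OnVariety.
End ProjectiveGeometry.

(* Main.v *)
Require Import Defs.
From HB Require Import structures.
From mathcomp Require Import all_boot all_order all_algebra.
From mathcomp Require Import reals complex mpoly.
From mathcomp Require Import ring.
From Stdlib Require Import Classical ClassicalEpsilon.

(** The exponents of -1 and of the g_k agree on both sides as integers, so all
    the content is that every g_k(P) is non-zero: for g_1(P) = 0 the two sides
    could differ, since a product of powers of 0 depends on how it is grouped.

    Let A = O_{X,P} with maximal ideal M = (x_0, x_j).  A is noetherian, x_0 is
    prime, and A/(x_0) is a discrete valuation ring with uniformizer x_j; it
    follows that every prime ideal of A other than 0 and M is principal.  Such
    a prime is the ideal of a curve E through P, and g = f / (x_0^m x_j^n) is a
    unit of O_{X,E}: for E other than C_0 and C_j because ord_E f = 0.  If g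
    were not in A, a maximal conductor ideal (A : c g) would be a prime I other
    than 0 and M with g not in A_I, a contradiction.  The same applies to 1/g,
    so that g is a unit of A. *)

Set Implicit Arguments.
Unset Strict Implicit.
Unset Printing Implicit Defensive.

Import Order.TTheory GRing.Theory Num.Theory.
Local Open Scope ring_scope.

(** * Ideals, the ascending chain condition and noetherian induction *)

Section Noetherian.
Variables (R : comNzRingType) (A : R -> Prop).

(** Rings and ideals are predicates on an ambient ring, since the local rings at points and along
    curves are all subsets of one function field. *)
Record ideal (I : R -> Prop) : Prop := Ideal {
  ideal_sub : forall a, I a -> A a;
  ideal0 : I 0;
  idealD : forall a b, I a -> I b -> I (a + b);
  idealM : forall c a, A c -> I a -> I (c * a)
}.

Definition noetherian := forall I : nat -> R -> Prop,
  (forall n, ideal (I n)) -> (forall n a, I n a -> I n.+1 a) ->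
  exists n, forall m a, I m a -> I n a.

Lemma chain_le (I : nat -> R -> Prop) : (forall n a, I n a -> I n.+1 a) ->
  forall m n, (m <= n)%N -> forall a, I m a -> I n a.
Proof.
move=> incI m n; elim: n => [|n IHn]; first by rewrite leqn0 => /eqP->.
rewrite leq_eqVlt => /orP[/eqP->//|]; rewrite ltnS => mn a Ia.
exact/incI/IHn.
Qed.

(** If [Q] failed somewhere, every failing ideal would have a strictly larger failing one; choosing
    these repeatedly gives a chain that never stabilizes. *)
Lemma noetherian_ind (Q : (R -> Prop) -> Prop) : noetherian ->
  (forall I, ideal I ->
    (forall J, ideal J -> (forall a, I a -> J a) ->
       ~ (forall a, J a -> I a) -> Q J) -> Q I) ->
  forall I, ideal I -> Q I.
Proof.
move=> noethA indQ I idI; apply: NNPP => nQI.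
pose T := {J | ideal J /\ ~ Q J}.
have next (s : T) : {t : T | (forall a, sval s a -> sval t a) /\
    ~ (forall a, sval t a -> sval s a)}.
  apply: constructive_indefinite_description.
  case: s => J [idJ nQJ]; apply: NNPP => nex; apply/nQJ/indQ => // L idL JL nLJ.
  apply: NNPP => nQL; apply: nex.
  by exists (exist _ L (conj idL nQL)).
pose s n := iter n (fun t => sval (next t)) (exist _ I (conj idI nQI) : T).
have [|n a|n nP] := noethA (fun n => sval (s n)).
- by move=> n; case: (s n) => J [].
- exact: (proj1 (svalP (next (s n)))).
- exact: (proj2 (svalP (next (s n)))) (nP n.+1).
Qed.

End Noetherian.

(** * Noetherian local domains inside a field *)

Section LocalRing.
Variables (K : fieldType) (A : K -> Prop).
Hypotheses (A1 : A 1) (AB : forall a b, A a -> A b -> A (a - b)).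
Hypothesis (AM : forall a b, A a -> A b -> A (a * b)).
Hypothesis noethA : noetherian A.
Variable M : K -> Prop.
Hypotheses (idM : ideal A M) (M1 : ~ M 1).
Hypothesis MV : forall a, A a -> ~ M a -> A a^-1.

Record prime_ideal (P : K -> Prop) : Prop := PrimeIdeal {
  prime_ideal_ideal : ideal A P;
  prime_ideal1 : ~ P 1;
  prime_idealM : forall a b, A a -> A b -> P (a * b) -> P a \/ P b
}.

Lemma eq_prime_ideal P Q : (forall f, P f <-> Q f) -> prime_ideal P -> prime_ideal Q.
Proof.
move=> eqPQ [[PA P0 PD PM] P1 Pprime]; split; last 2 first.
- by move/eqPQ.
- by move=> a b Aa Ab /eqPQ /Pprime[]// /eqPQ; [left | right].
split.
- by move=> a /eqPQ /PA.
- exact/eqPQ.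
- by move=> a b /eqPQ Pa /eqPQ Pb; apply/eqPQ/PD.
- by move=> c a Ac /eqPQ Pa; apply/eqPQ/PM.
Qed.

Lemma subring0 : A 0.
Proof. by rewrite -(subrr (1 : K)); exact: AB. Qed.

Lemma subringD a b : A a -> A b -> A (a + b).
Proof.
move=> Aa Ab; have -> : a + b = a - (0 - b) by ring.
by apply: AB => //; apply: AB => //; exact: subring0.
Qed.

Lemma subringX a n : A a -> A (a ^+ n).
Proof. by move=> Aa; elim: n => [|n IHn]; rewrite ?expr0 // exprS; apply: AM. Qed.

Lemma idealB I a b : ideal A I -> I a -> I b -> I (a - b).
Proof.
move=> idI Ia Ib; have -> : a - b = a + (0 - 1) * b by ring.
apply: (idealD idI) => //; apply: (idealM idI) => //.
by apply: AB => //; exact: subring0.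
Qed.

Lemma prime_sub_max P : prime_ideal P -> forall f, P f -> M f.
Proof.
move=> prP f Pf; apply: NNPP => nMf; apply: (prime_ideal1 prP).
have idP := prime_ideal_ideal prP.
have f_neq0 : f != 0 by apply/eqP => e; apply: nMf; rewrite e; apply: ideal0 idM.
rewrite -(mulVf f_neq0); apply: (idealM idP _ Pf).
exact: MV (ideal_sub idP Pf) nMf.
Qed.

(* Krull's intersection theorem modulo p, for elements that are explicitly
   divisible infinitely often by x. *)
Lemma descent (p x : K) (Q : K -> Prop) : A p -> M x ->
  (forall q, Q q -> A q /\ exists s q1, [/\ A s, Q q1 & q = p * s + x * q1]) ->
  forall q, Q q -> exists2 s, A s & q = p * s.
Proof.
move=> Ap Mx Qx.
have Ax : A x by exact: ideal_sub idM _ Mx.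
pose pq q f := exists s t, [/\ A s, A t & f = p * s + q * t].
have id_pq q : A q -> ideal A (pq q).
  move=> Aq; split.
  - by move=> a [s [t [As At ->]]]; apply: subringD; apply: AM.
  - by exists 0, 0; split; [exact: subring0 | exact: subring0 | ring].
  - move=> a b [s [t [As At ->]]] [s' [t' [As' At' ->]]].
    by exists (s + s'), (t + t'); split; [exact: subringD | exact: subringD | ring].
  - move=> c a Ac [s [t [As At ->]]].
    by exists (c * s), (c * t); split; [exact: AM | exact: AM | ring].
(* Induction on the ideal (p, q): as q = p s + x q1, it is contained in (p, q1). *)
have ind I : ideal A I -> forall q, Q q -> I = pq q -> exists2 s, A s & q = p * s.
  move: I; apply: (noetherian_ind noethA) => I idI IHI q Qq defI.
  have [Aq [s [q1 [As Qq1 defq]]]] := Qx q Qq.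
  have [Aq1 _] := Qx q1 Qq1.
  suff [s1 As1 defq1] : exists2 s, A s & q1 = p * s.
    exists (s + x * s1); last by rewrite defq defq1; ring.
    by apply: subringD => //; apply: AM.
  have [sub|nsub] := classic (forall a, pq q1 a -> pq q a); last first.
    apply: (IHI (pq q1)) => //; [exact: id_pq | | by rewrite defI].
    rewrite defI => a [u [v [Au Av ->]]].
    exists (u + s * v), (x * v); split; last by rewrite defq; ring.
      by apply: subringD => //; apply: AM.
    exact: AM.
  (* If the two ideals coincide, q1 = p u + q v gives (1 - x v) q1 = p (u + s v), and 1 - x v is a
     unit because [x] is in [M]. *)
  have [|u [v [Au Av defq1]]] := sub q1.
    by exists 0, 1; split; [exact: subring0 | | ring].
  have nM : ~ M (1 - x * v).
    move=> M1xv; apply: M1; rewrite -(subrK (x * v) 1).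
    by apply: (idealD idM) => //; rewrite mulrC; apply: (idealM idM).
  have A1xv : A (1 - x * v) by apply: AB => //; apply: AM.
  have nz : 1 - x * v != 0 by apply/eqP => e; apply: nM; rewrite e; apply: ideal0 idM.
  exists ((u + s * v) / (1 - x * v)).
    by apply: AM; [apply: subringD => //; exact: AM | exact: MV].
  apply: (mulIf nz); rewrite mulrA mulfVK //.
  by rewrite mulrBr mulr1 {1}defq1 {1}defq; ring.
move=> q Qq; have [Aq _] := Qx q Qq.
exact: ind (id_pq q Aq) q Qq erefl.
Qed.

(** An element without such a factorization is [p] times another one of the same kind, so [descent]
    modulo 0 shows that it is 0. *)
Lemma principal_prime_decomp P p : prime_ideal P ->
  (forall f, P f <-> exists2 a, A a & f = a * p) ->
  forall a, A a -> a != 0 -> exists n b, [/\ A b, ~ P b & a = p ^+ n * b].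
Proof.
move=> prP defP a Aa /eqP a_neq0; apply: NNPP => nex; apply: a_neq0.
have Pp : P p by apply/defP; exists 1; rewrite ?mul1r.
pose Q q := A q /\ ~ exists n b, [/\ A b, ~ P b & q = p ^+ n * b].
have [q [Aq nexq]|//|s _ ->] := @descent 0 p Q subring0 (prime_sub_max prP Pp) _ a; last exact: mul0r.
  split=> //; have [Pq|nPq] := classic (P q); last first.
    by case: nexq; exists 0%N, q; split=> //; rewrite mul1r.
  have [q1 Aq1 defq] := (proj1 (defP q)) Pq.
  exists 0, q1; split; [exact: subring0 | | by rewrite defq; ring].
  split=> // -[n [b [Ab nPb defq1]]]; apply: nexq.
  by exists n.+1, b; split; rewrite // defq defq1 exprSr; ring.
Qed.

(** * Primes and regular elements in dimension two *)

Variables x y : K.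
Hypotheses (x_neq0 : x != 0) (Mx : M x) (My : M y).
Hypothesis Mxy : forall f, M f -> exists a b, [/\ A a, A b & f = a * x + b * y].
Let mulx f := exists2 a, A a & f = a * x.
Hypotheses (prx : prime_ideal mulx) (nxy : ~ mulx y).

Let Ax : A x. Proof. exact: ideal_sub idM _ Mx. Qed.
Let Ay : A y. Proof. exact: ideal_sub idM _ My. Qed.

(* A / (x) is a discrete valuation ring with uniformizer y. *)
Let valuation_mod_x a : A a -> ~ mulx a ->
  exists n u t, [/\ A u, ~ M u, A t & a = y ^+ n * u + x * t].
Proof.
move=> Aa nxa; apply: NNPP => nex; apply: nxa.
pose Q q := A q /\
  ~ exists n u t, [/\ A u, ~ M u, A t & q = y ^+ n * u + x * t].
have [q [Aq nexq]|//|s As ->] := @descent x y Q Ax My _ a; last first.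
- by exists s => //; rewrite mulrC.
split=> //; have [Mq|nMq] := classic (M q); last first.
  case: nexq; exists 0%N, q, 0; split=> //; first exact: subring0.
  by ring.
have [s [q1 [As Aq1 defq]]] := Mxy Mq.
exists s, q1; split=> //; last by rewrite defq; ring.
split=> // -[n [u [t [Au nMu At defq1]]]]; apply: nexq.
exists n.+1, u, (s + y * t); split=> //.
  by apply: subringD => //; apply: AM.
by rewrite defq defq1 exprS; ring.
Qed.

(** If [x] is in [P], then P = (x), since otherwise [P] would contain a power of [y], hence [y] and
    all of [M]. If not, take [p] in [P] of least [y]-valuation modulo [x]: every element of [P] is a
    multiple of [p] plus [x] times an element of [P], and [descent] removes the remainder. *)
Lemma prime_principal P : prime_ideal P -> (exists2 f, P f & f != 0) ->
  ~ (forall f, M f -> P f) ->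
  exists p, forall f, P f <-> exists2 a, A a & f = a * p.
Proof.
move=> prP [f0 Pf0 f0_neq0] nMP; have idP := prime_ideal_ideal prP.
have PA f : P f -> A f by exact: ideal_sub idP f.
have PM f : P f -> M f by exact: prime_sub_max prP f.
have [Px|nPx] := classic (P x).
  exists x => f; split=> [Pf|[a Aa ->]]; last exact: idealM idP _ _ Aa Px.
  apply: NNPP => nxf.
  have [n [u [t [Au nMu At deff]]]] := valuation_mod_x (PA _ Pf) nxf.
  have : P (y ^+ n * u).
    rewrite (_ : _ * u = f - t * x); last by rewrite deff; ring.
    by apply: (idealB idP) => //; apply: (idealM idP).
  case/(prime_idealM prP) => [||Pyn|/PM//]; [exact: subringX | by [] |].
  suff Py : P y.
    apply: nMP => g /Mxy [a [b [Aa Ab ->]]].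
    by apply: (idealD idP) => //; apply: (idealM idP).
  elim: n Pyn {deff} => [/(prime_ideal1 prP)//|n IHn]; rewrite exprS.
  by case/(prime_idealM prP) => //; exact: subringX.
have divx q t : P q -> A t -> q = x * t -> P t.
  by move=> Pq At defq; move: Pq; rewrite defq => /(prime_idealM prP) [].
pose V n := exists p u t, [/\ P p, A u, ~ M u, A t & p = y ^+ n * u + x * t].
(* Otherwise [P] would lie in (x); quotients by [x] stay in [P], so [descent] would make [f0]
   zero. *)
have [n0 Vn0] : exists n, V n.
  apply: NNPP => nV; case/eqP: f0_neq0.
  have [q Pq|//|s _ ->] := @descent 0 x P subring0 Mx _ f0; last exact: mul0r.
  split; first exact: PA.
  have [t At defq] : mulx q.
    apply: NNPP => /(valuation_mod_x (PA _ Pq)) [n [u [t [Au nMu At defq]]]].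
    by apply: nV; exists n, q, u, t.
  exists 0, t; split; [exact: subring0 | | by rewrite defq; ring].
  by apply: divx Pq At _; rewrite mulrC.
have [n Vn minV] : exists2 n, V n & forall m, V m -> (n <= m)%N.
  apply: NNPP => nex; elim/ltn_ind: n0 Vn0 => m IHm Vm.
  by apply: nex; exists m => // l Vl; rewrite leqNgt; apply/negP => /IHm.
case: Vn => p [u [t [Pp Au nMu At defp]]].
have u_neq0 : u != 0 by apply/eqP => e; apply: nMu; rewrite e; apply: ideal0 idM.
exists p => f; split=> [Pf|[a Aa ->]]; last exact: idealM idP _ _ Aa Pp.
suff [s As ->] : exists2 s, A s & f = p * s by exists s; rewrite // mulrC.
apply: (@descent p x P) => //; first exact: PA.
move=> q Pq; split; first exact: PA.
suff [s As [t1 At1 deft1]] : exists2 s, A s & exists2 t, A t & q - p * s = x * t.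
  exists s, t1; split=> //; last by rewrite -deft1; ring.
  apply: divx At1 deft1; apply: (idealB idP) => //.
  by rewrite mulrC; apply: (idealM idP).
have [[t1 At1 defq]|nxq] := classic (mulx q).
  by exists 0; [exact: subring0 | exists t1; rewrite // defq; ring].
have [m [u1 [t1 [Au1 nMu1 At1 defq]]]] := valuation_mod_x (PA _ Pq) nxq.
have le_nm : (n <= m)%N by apply: minV; exists q, u1, t1.
have AV := MV Au nMu.
have Ay' : A (y ^+ (m - n)) by exact: subringX.
(* This multiple of [p] cancels the term y^m u1 of [q]; what remains is divisible by [x]. *)
exists (y ^+ (m - n) * u1 / u); first by do !apply: AM.
exists (t1 - t * (y ^+ (m - n) * u1 / u)).
  by apply: AB => //; do !apply: AM.
rewrite defq defp -{1}(subnK le_nm) exprD.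
by field.
Qed.

(** An algebraic Hartogs principle, proved for all c g with c in [A] under the assumption that c g
    is outside [A], by noetherian induction on the conductor of c. *)
Lemma regular_in_codim1 g : (exists a b, [/\ A a, A b & g = a / b]) ->
  (forall P, prime_ideal P -> (exists2 f, P f & f != 0) ->
     ~ (forall f, M f -> P f) -> exists a b, [/\ A a, A b, ~ P b & g = a / b]) ->
  A g.
Proof.
move=> [a [b [Aa Ab defg]]] codim1.
have [b0|b_neq0] := eqVneq b 0.
  by rewrite defg b0 invr0 mulr0; exact: subring0.
pose conductor c z := A z /\ A (z * (c * g)).
have idc c : ideal A (conductor c).
  split.
  - by move=> z [].
  - by rewrite /conductor mul0r; split; exact: subring0.
  - move=> z w [Az Azg] [Aw Awg]; split; first exact: subringD.
    by rewrite mulrDl; apply: subringD.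
  - move=> z w Az [Aw Awg]; split; first exact: AM.
    by rewrite -mulrA; apply: AM.
suff ind I : ideal A I -> forall c, A c -> I = conductor c -> A (c * g).
  by rewrite -(mul1r g); apply: ind (idc 1) 1 A1 erefl.
move: I; apply: (noetherian_ind noethA) => J _ IHJ c Ac defJ.
subst J; apply: NNPP => nAcg.
have nc1 : ~ conductor c 1 by case; rewrite mul1r.
have prc : prime_ideal (conductor c).
  (* The conductor of [z * c] contains [w], so it is strictly larger than that of [c], and the
     induction hypothesis puts z c g in [A]. *)
  split=> // z w Az Aw [_ Azw]; apply: NNPP => /not_or_and [nz nw]; apply: nz.
  split=> //; rewrite mulrA; apply: (IHJ (conductor (z * c))) => //; last exact: AM.
    move=> v [Av Avg]; split=> //.
    by rewrite (_ : _ * _ = z * (v * (c * g))); [apply: AM | ring].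
  move=> sub; apply: nw; apply: sub; split=> //.
  by rewrite (_ : _ * _ = z * w * (c * g)); last ring.
have [||a1 [b1 [Aa1 Ab1 nb1 defg1]]] := codim1 _ prc.
- exists b => //; split=> //.
  by rewrite defg (_ : b * _ = c * a); [apply: AM | field].
(* Here x c g and y c g are both in [A]. The prime [x] divides y (x c g) but not [y], so it divides
   x c g, and c g is in [A]. *)
- move=> Mc; have [_ Axg] := Mc x Mx; have [_ Ayg] := Mc y My.
  have : mulx (y * (x * (c * g))).
    by exists (y * (c * g)); last ring.
  case/(prime_idealM prx) => // -[d Ad defxcg].
  by apply: nAcg; rewrite (mulfI x_neq0 (etrans defxcg (mulrC _ _))).
- apply: nb1; split=> //.
  have [b10|b1_neq0] := eqVneq b1 0; first by rewrite b10 mul0r; exact: subring0.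
  by rewrite defg1 (_ : b1 * _ = c * a1); [apply: AM | field].
Qed.

End LocalRing.

(** * Noetherian polynomial rings *)

Lemma noetherian_transfer (R R' : comNzRingType) (A : R -> Prop) (A' : R' -> Prop)
    (phi : (R' -> Prop) -> R -> Prop) :
  (forall I, ideal A' I -> ideal A (phi I)) ->
  (forall I J : R' -> Prop, (forall a, I a -> J a) -> forall a, phi I a -> phi J a) ->
  (forall I J, ideal A' I -> ideal A' J ->
     (forall a, phi J a -> phi I a) -> forall a, J a -> I a) ->
  noetherian A -> noetherian A'.
Proof.
move=> phi_ideal phi_mono phi_refl noethA I idI incI.
have [||n stab] := noethA (fun n => phi (I n)).
- by move=> n; apply: phi_ideal.
- by move=> i; apply: phi_mono; apply: incI.
- by exists n => m; apply: phi_refl => //; apply: stab.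
Qed.

Lemma noetherian_surj (R R' : comNzRingType) (f : {rmorphism R -> R'}) :
  (forall b, exists a, f a = b) ->
  noetherian (fun _ : R => True) -> noetherian (fun _ : R' => True).
Proof.
move=> surj; apply: (noetherian_transfer (phi := fun I a => I (f a))).
- move=> I idI; split=> // [|a b Ia Ib|c a _ Ia].
  + by rewrite rmorph0; apply: ideal0 idI.
  + by rewrite rmorphD; apply: (idealD idI).
  + by rewrite rmorphM; apply: (idealM idI).
- by move=> I J IJ a; apply: IJ.
- by move=> I J _ _ JI b; have [a <-] := surj b; apply: JI.
Qed.

Lemma noetherian_field (F : fieldType) : noetherian (fun _ : F => True).
Proof.
move=> I idI incI.
have [[n [a [Ia a_neq0]]]|nex] := classic (exists n a, I n a /\ a != 0).
  by exists n => m b _; rewrite -(mulfVK a_neq0 b); apply: (idealM (idI n)).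
exists 0%N => m a Ia; have [->|a_neq0] := eqVneq a 0; first exact: ideal0 (idI 0%N).
by case: nex; exists m, a.
Qed.

Section HilbertBasis.
Variable R : comNzRingType.
Implicit Types I : {poly R} -> Prop.

Let lead_ideal I d a := exists p, [/\ I p, (size p <= d.+1)%N & p`_d = a].

Let ideal_lead I d : ideal (fun=> True) I -> ideal (fun=> True) (lead_ideal I d).
Proof.
move=> idI; split=> //.
- by exists 0; rewrite size_poly0 coef0; split=> //; apply: ideal0 idI.
- move=> a b [p [Ip sp <-]] [q [Iq sq <-]]; exists (p + q).
  rewrite coefD (leq_trans (size_polyD _ _)) ?geq_max ?sp //.
  by split=> //; apply: (idealD idI).
- move=> c a _ [p [Ip sp <-]]; exists (c *: p).
  rewrite coefZ (leq_trans (size_scale_leq _ _)) //.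
  by split=> //; rewrite -mul_polyC; apply: (idealM idI).
Qed.

Let leadS I d a : ideal (fun=> True) I -> lead_ideal I d a -> lead_ideal I d.+1 a.
Proof.
move=> idI [p [Ip sp <-]]; exists ('X * p); split; first exact: (idealM idI).
  rewrite (leq_trans (size_polyMleq _ _)) // size_polyX.
  by rewrite addSn /= add1n ltnS.
by rewrite coefXM.
Qed.

Let lead_sub I J d a : (forall p, I p -> J p) -> lead_ideal I d a -> lead_ideal J d a.
Proof. by move=> IJ [p [Ip sp <-]]; exists p; split=> //; apply: IJ. Qed.

(** The diagonal chain of leading ideals stabilizes at some [n0], which settles all degrees from
    [n0] on; the finitely many lower degrees are settled one at a time. Nested ideals with the same
    leading ideals coincide. *)
Lemma hilbert_basis : noetherian (fun _ : R => True) ->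
  noetherian (fun _ : {poly R} => True).
Proof.
move=> noethR I idI incI.
have sub := chain_le incI.
have leadle m : forall d e, (d <= e)%N ->
    forall a, lead_ideal (I m) d a -> lead_ideal (I m) e a.
  by apply: chain_le => d a; apply: leadS.
have [|n a|n0 stab0] := noethR (fun n => lead_ideal (I n) n).
- by move=> n; apply: ideal_lead.
- by move/(leadS (idI n)); apply: lead_sub; apply: incI.
have [n1 stab1] : exists n, forall d, (d < n0)%N -> forall m a,
    lead_ideal (I m) d a -> lead_ideal (I n) d a.
  elim: n0 {stab0} => [|d [n stab]]; first by exists 0%N.
  have [|m a|n' stab'] := noethR (fun n => lead_ideal (I n) d).
  - by move=> m; apply: ideal_lead.
  - by apply: lead_sub; apply: incI.
  exists (maxn n n') => e; rewrite ltnS leq_eqVlt => /orP[/eqP->|lt_ed] m a.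
    by move/stab'; apply: lead_sub; apply: sub; exact: leq_maxr.
  by move/(stab e lt_ed); apply: lead_sub; apply: sub; exact: leq_maxl.
exists (maxn n0 n1).
have stab m d a : lead_ideal (I m) d a -> lead_ideal (I (maxn n0 n1)) d a.
  have [/stab1 lead_n1|le_n0d] := ltnP d n0.
    by move/lead_n1; apply: lead_sub; apply: sub; exact: leq_maxr.
  move=> lead_m.
  have /stab0 : lead_ideal (I (maxn d m)) (maxn d m) a.
    apply: leadle (leq_maxl d m) _ _; move: lead_m.
    by apply: lead_sub; apply: sub; exact: leq_maxr.
  move/(leadle _ _ _ le_n0d); apply: lead_sub; apply: sub; exact: leq_maxl.
move=> m p; move: (leqnn (size p)); move: {2}(size p) => d.
elim: d m p => [|d IHd] m p.
  rewrite leqn0 size_poly_eq0 => /eqP-> _; exact: ideal0 (idI _).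
move=> sp Ip.
(* [q] agrees with [p] in degree d, so p - q is shorter. It may lie only in a later ideal of the
   chain, which is why the induction is over all [m]. *)
have /stab[q [Iq sq defq]] : lead_ideal (I m) d p`_d by exists p.
rewrite -(subrK q p); apply: (idealD (idI _)) => //.
apply: (IHd (maxn m (maxn n0 n1))).
  apply/leq_sizeP => i; rewrite leq_eqVlt coefB => /orP[/eqP<-|lt_di].
    by rewrite defq subrr.
  by rewrite !nth_default ?subrr //; [exact: leq_trans sq _ | exact: leq_trans sp _].
rewrite -mulN1r; apply: (idealD (idI _)); first exact: sub (leq_maxl _ _) _ Ip.
apply: (idealM (idI _)) => //; exact: sub (leq_maxr _ _) _ Iq.
Qed.

End HilbertBasis.

(** Sending the variable of [{poly {mpoly F[n]}}] to the last variable gives a surjection onto the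
    ring in n + 1 variables. *)
Lemma noetherian_mpoly (F : fieldType) n : noetherian (fun _ : {mpoly F[n]} => True).
Proof.
elim: n => [|n IHn].
  apply: (noetherian_surj (f := mpolyC 0 (R := F))); last exact: noetherian_field.
  by move=> p; exists p@_0%MM; exact/esym/nvar0_mpolyC.
pose f : {rmorphism {poly {mpoly F[n]}} -> {mpoly F[n.+1]}} :=
  horner_eval 'X_ord_max \o map_poly (@mwiden n F).
apply: (noetherian_surj (f := f)); last exact: hilbert_basis.
have fC q : f q%:P = mwiden q by rewrite /f /= map_polyC /horner_eval hornerC.
have fX : f 'X = 'X_ord_max by rewrite /f /= map_polyX /horner_eval hornerX.
have im_X i : exists q, f q = 'X_i.
  case: (unliftP ord_max i) => [j ->|->]; last by exists 'X.
  exists ('X_j)%:P; rewrite fC mwidenX mnmwiden1; congr 'X_[U_(_)]; apply: val_inj => /=.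
  by rewrite /bump leqNgt ltn_ord.
have im_mon m : exists q, f q = 'X_[m].
  rewrite mpolyXE_id; elim/big_rec: _ => [|i _ _ [q <-]]; first by exists 1; rewrite rmorph1.
  by have [q' <-] := im_X i; exists (q' ^+ m i * q); rewrite rmorphM rmorphXn.
move=> p; rewrite (mpolyE p); elim/big_rec: _ => [|m _ _ [q <-]].
  by exists 0; rewrite rmorph0.
have [q' <-] := im_mon m; exists ((p@_m)%:MP%:P * q' + q).
by rewrite rmorphD rmorphM fC mwidenC mul_mpolyC.
Qed.

(** * The local ring at P, with [X_a] as the coordinate that does not vanish there *)

Section LocalRingAtPoint.
Variables (k : closedFieldType) (N : nat) (X : variety k N) (P : point k N).
Variable a : 'I_N.+1.
Hypotheses (Pa : P a != 0) (PX : lies_on P X).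
Local Notation S := {mpoly k[N.+1]}.
Local Notation K := (funfield X).
Local Notation "F ^gen" := (mmap (const X) (@gen_coord _ _ X) F)
  (at level 2, format "F ^gen").
Local Notation za := (@gen_coord _ _ X a).
Local Notation A := (@local_ring _ _ X (vanish P)).
Local Notation M := (@local_max _ _ X (vanish P)).

Lemma homogX i : ('X_i : S) \is 1.-homog.
Proof. by rewrite dhomogX; apply/eqP/mdeg1. Qed.

Lemma homogXn i d : ('X_i ^+ d : S) \is d.-homog.
Proof. by rewrite -{2}(mul1n d); apply: dhomogMn; apply: homogX. Qed.

Lemma homogMC d e (F G : S) : F \is d.-homog -> G \is e.-homog -> G * F \is (d + e).-homog.
Proof. by move=> hF hG; rewrite addnC; apply: dhomogM. Qed.

Lemma gen_neq0 d (F : S) : F \is d.-homog -> ~ vanish P F -> F^gen != 0.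
Proof. by move=> hF nPF; apply/eqP => /(gen_coordP _ hF) /PX. Qed.

Lemma gen_Xn i d : ('X_i ^+ d)^gen = @gen_coord _ _ X i ^+ d.
Proof. by rewrite rmorphXn /= mmapX mmap1U. Qed.

Lemma vanish_Xn d : ~ vanish P ('X_a ^+ d).
Proof. by rewrite /vanish rmorphXn /= mevalXU; apply/eqP/expf_neq0. Qed.

Lemma za_neq0 : za != 0.
Proof. by have := gen_neq0 (homogXn a 1) (@vanish_Xn 1); rewrite gen_Xn. Qed.

(* The dehomogenization of F at X_a, graded by the degree in X_0, ..., X_N. *)
Definition dehom (F : S) : {poly K} :=
  mmap (polyC \o const X) (fun i => (@gen_coord _ _ X i / za) *: 'X) F.

Lemma dehom_homog d (F : S) : F \is d.-homog -> dehom F = (F^gen / za ^+ d) *: 'X^d.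
Proof.
move=> /dhomogP hF; rewrite /dehom /mmap mulr_suml scaler_suml.
apply: eq_big_seq => m /hF /= deg_m.
rewrite /mmap1 -mulrA -scalerA -mul_polyC; congr (_ * _).
rewrite -deg_m mdegE -!prodrXr -prodf_div -scaler_prod.
by apply: eq_bigr => i _; rewrite exprZn expr_div_n.
Qed.

Lemma coef_dehom d (F : S) : (dehom F)`_d = (pihomog mdeg d F)^gen / za ^+ d.
Proof.
pose n := maxn (mmeasure mdeg F) d.+1.
rewrite {1}(pihomog_partitionE (leq_maxl _ _ : mmeasure mdeg F <= n)%N).
have lt_dn : (d < n)%N by exact: leq_maxr.
rewrite /dehom raddf_sum coef_sum (bigD1 (Ordinal lt_dn)) //=.
rewrite -/(dehom _) (dehom_homog (pihomogP _ _ _)) coefZ coefXn eqxx mulr1.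
rewrite big1 ?addr0 // => i ne_id.
rewrite -/(dehom _) (dehom_homog (pihomogP _ _ _)) coefZ coefXn.
by rewrite (_ : (d == i) = false) ?mulr0 //; apply/eqP => e; case/eqP: ne_id; apply: val_inj.
Qed.

Lemma local_ring_mk d (F G : S) : F \is d.-homog -> G \is d.-homog -> ~ vanish P G ->
  A (F^gen / G^gen).
Proof. by move=> hF hG nPG; exists d, F, G. Qed.

Lemma local_ring_dehom d (F : S) : A (dehom F)`_d.
Proof.
rewrite coef_dehom -gen_Xn.
exact: local_ring_mk (pihomogP _ _ _) (homogXn a d) (@vanish_Xn d).
Qed.

Lemma vanishM F G : vanish P (F * G) -> vanish P F \/ vanish P G.
Proof. by rewrite /vanish mevalM => /eqP; rewrite mulf_eq0 => /orP[]/eqP; [left|right]. Qed.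

Lemma nvanishM F G : ~ vanish P F -> ~ vanish P G -> ~ vanish P (F * G).
Proof. by move=> nF nG /vanishM[]. Qed.

Lemma local_ring1 : A 1.
Proof.
exists 0%N, 1, 1; rewrite dhomog1; split=> //; first by rewrite /vanish rmorph1; apply/eqP/oner_neq0.
by rewrite rmorph1 divr1.
Qed.

Lemma local_ringM (x : S -> Prop) (f g : K) :
  (forall F G, x (F * G) -> x F \/ x G) ->
  local_ring x f -> local_ring x g -> local_ring x (f * g).
Proof.
move=> xM [d [F [G [hF hG _ nG ->]]]] [e [F' [G' [hF' hG' _ nG' ->]]]].
exists (d + e)%N, (F * F'), (G * G'); split=> //; try exact: dhomogM.
  by case/xM.
by rewrite !rmorphM /= mulf_div.
Qed.

Lemma local_ringB f g : A f -> A g -> A (f - g).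
Proof.
move=> [d [F [G [hF hG _ nG ->]]]] [e [F' [G' [hF' hG' _ nG' ->]]]].
exists (d + e)%N, (F * G' - F' * G), (G * G'); split=> //; try exact: dhomogM.
- by apply: rpredB; [exact: dhomogM | exact: homogMC].
- exact: nvanishM.
have := gen_neq0 hG nG; have := gen_neq0 hG' nG'.
by rewrite rmorphB !rmorphM /= => ? ?; field; apply/andP.
Qed.

(* The primes of S between the ideal of X and the ideal of P, homogeneous or
   not; [vanish P] itself is one of them. *)
Record prime_at (J : S -> Prop) : Prop := PrimeAt {
  prime_at0 : J 0;
  prime_atD : forall F G, J F -> J G -> J (F + G);
  prime_atM : forall F G, J G -> J (F * G);
  prime_at_prime : forall F G, J (F * G) -> J F \/ J G;
  prime_at_sup : forall F, X F -> J F;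
  prime_at_sub : forall F, J F -> vanish P F
}.

Lemma prime_at_vanish : prime_at (vanish P).
Proof.
split=> //.
- exact: rmorph0.
- by move=> F G; rewrite /vanish mevalD => -> ->; rewrite addr0.
- by move=> F G; rewrite /vanish mevalM => ->; rewrite mulr0.
- exact: vanishM.
Qed.

Lemma prime_at_closed (W : homog_prime k N) : closed_sub W X -> lies_on P W -> prime_at W.
Proof. by case: W => *; split. Qed.

Section PrimeAt.
Variable J : S -> Prop.
Hypothesis prJ : prime_at J.
Local Notation IJ := (@local_ideal _ _ X (vanish P) J).

(** Membership does not depend on the fraction: if F/G = F'/G' with F' in [J], then F G' - F' G is
    an equation of X, so F G' is in [J], while G' is not since it does not vanish at P. *)
Lemma mem_local_ideal d (F G : S) : F \is d.-homog -> G \is d.-homog ->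
  ~ vanish P G -> IJ (F^gen / G^gen) <-> J F.
Proof.
move=> hF hG nG; split=> [[e [F' [G' [hF' hG' JF' nG' eqFG]]]]|JF]; last by exists d, F, G.
have : J (F * G' - F' * G).
  apply: (prime_at_sup prJ); apply/(@gen_coordP _ _ X (d + e)).
    by apply: rpredB; [exact: dhomogM | exact: homogMC].
  have := gen_neq0 hG nG; have := gen_neq0 hG' nG'.
  rewrite rmorphB !rmorphM /= => nz' nz.
  by apply/eqP; rewrite subr_eq0 -eqr_div // eqFG.
move=> /prime_atD -/(_ prJ (G * F') (prime_atM prJ _ JF')).
rewrite mulrC [F' * G]mulrC subrK => /(prime_at_prime prJ)[/(prime_at_sub prJ)//|//].
Qed.

Lemma local_ideal_ideal : ideal A IJ.
Proof.
split.
- by move=> f [d [F [G [hF hG _ nG ->]]]]; exact: local_ring_mk hF hG nG.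
- exists 0%N, 0, 1; rewrite dhomog1 dhomog0; split=> //; first exact: prime_at0.
    by rewrite /vanish rmorph1; apply/eqP/oner_neq0.
  by rewrite rmorph0 mul0r.
- move=> f g [d [F [G [hF hG JF nG ->]]]] [e [F' [G' [hF' hG' JF' nG' ->]]]].
  exists (d + e)%N, (F * G' + G * F'), (G * G'); split=> //; try exact: dhomogM.
  + by apply: rpredD; [exact: dhomogM | apply: dhomogM].
  + by apply: (prime_atD prJ); [rewrite mulrC|]; apply: (prime_atM prJ).
  + exact: nvanishM.
  have := gen_neq0 hG nG; have := gen_neq0 hG' nG'.
  by rewrite rmorphD !rmorphM /= => ? ?; field; apply/andP.
- move=> f g [d [F [G [hF hG _ nG ->]]]] [e [F' [G' [hF' hG' JF' nG' ->]]]].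
  exists (d + e)%N, (F * F'), (G * G'); split=> //; try exact: dhomogM.
  + exact: (prime_atM prJ).
  + exact: nvanishM.
  by rewrite !rmorphM /= mulf_div.
Qed.

Lemma prime_local_ideal : prime_ideal A IJ.
Proof.
split; first exact: local_ideal_ideal.
  have n1 : ~ vanish P 1 by rewrite /vanish rmorph1; apply/eqP/oner_neq0.
  have -> : 1 = 1^gen / 1^gen :> K by rewrite rmorph1 divr1.
  by move/(mem_local_ideal (dhomog1 _ _) (dhomog1 _ _) n1)/(prime_at_sub prJ).
move=> f g [d [F [G [hF hG _ nG ->]]]] [e [F' [G' [hF' hG' _ nG' ->]]]].
rewrite mulf_div -!rmorphM.
move/(mem_local_ideal (dhomogM hF hF') (dhomogM hG hG') (nvanishM nG nG')).
by case/(prime_at_prime prJ) => ?; [left; exists d, F, G | right; exists e, F', G'].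
Qed.

End PrimeAt.

Lemma local_ringV (x : S -> Prop) (f : K) : local_ring x f -> ~ local_max x f -> local_ring x f^-1.
Proof.
move=> [d [F [G [hF hG _ nG ->]]]] nM; exists d, G, F; split; rewrite ?invf_div //.
by move=> xF; apply: nM; exists d, F, G.
Qed.

(** * From ideals of the local ring to homogeneous ideals and curves *)

(** A form F of degree d belongs to it when F / X_a^d is in [I]. Testing the coefficients of
    [dehom F] covers inhomogeneous F and turns products in [S] into products of polynomials. *)
Definition hideal (I : K -> Prop) (F : S) := forall d, I (dehom F)`_d.

Section HomogIdeal.
Variable I : K -> Prop.
Hypothesis idI : ideal A I.

Lemma ideal_sum (T : Type) (r : seq T) (Q : pred T) (F : T -> K) :
  (forall i, Q i -> I (F i)) -> I (\sum_(i <- r | Q i) F i).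
Proof. by move=> IF; elim/big_ind: _ => //; [exact: ideal0 idI | exact: idealD idI]. Qed.

Lemma ideal_hideal : ideal (fun=> True) (hideal I).
Proof.
split=> //.
- by move=> d; rewrite /dehom rmorph0 coef0; apply: ideal0 idI.
- by move=> F G IF IG d; rewrite /dehom rmorphD coefD; apply: (idealD idI).
- move=> F G _ IG d; rewrite /dehom rmorphM coefM; apply: ideal_sum => i _.
  by apply: (idealM idI); [exact: local_ring_dehom | exact: IG].
Qed.

Lemma hideal_homog d F : F \is d.-homog -> hideal I F <-> I (F^gen / za ^+ d).
Proof.
move=> hF; have dF := dehom_homog hF; split=> [/(_ d)|IF e].
  by rewrite dF coefZ coefXn eqxx mulr1.
by rewrite dF coefZ coefXn; case: eqP => _; rewrite ?mulr1 // mulr0; apply: ideal0 idI.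
Qed.

(** F / G and F / X_a^d differ by the factor X_a^d / G, a unit of the local ring. *)
Lemma local_hideal f : local_ideal (vanish P) (hideal I) f <-> I f.
Proof.
split=> [[d [F [G [hF hG IF nG ->]]]]|If].
  have nz : za ^+ d != 0 by rewrite expf_neq0 ?za_neq0.
  have nzG := gen_neq0 hG nG.
  have -> : F^gen / G^gen = ('X_a ^+ d)^gen / G^gen * (F^gen / za ^+ d).
    by rewrite gen_Xn; field; apply/andP.
  apply: (idealM idI); first exact: local_ring_mk (homogXn a d) hG nG.
  exact/(hideal_homog hF).
have [d [F [G [hF hG _ nG deff]]]] := ideal_sub idI If.
exists d, F, G; split=> //; apply/(hideal_homog hF).
have nz : za ^+ d != 0 by rewrite expf_neq0 ?za_neq0.
have nzG := gen_neq0 hG nG.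
have -> : F^gen / za ^+ d = G^gen / ('X_a ^+ d)^gen * f.
  by rewrite gen_Xn deff; field; apply/andP.
apply: (idealM idI) => //; exact: local_ring_mk hG (homogXn a d) (@vanish_Xn d).
Qed.

End HomogIdeal.

(** By [local_hideal] an ideal is recovered from its [hideal], so chains can be tested in the
    polynomial ring. *)
Lemma noetherian_local_ring : noetherian A.
Proof.
apply: (noetherian_transfer (phi := hideal)); last exact: noetherian_mpoly.
- exact: ideal_hideal.
- by move=> I J IJ F JF d; apply: IJ.
- move=> I J idI idJ JI f /(local_hideal idJ) [d [F [G [hF hG JF nG ->]]]].
  by apply/(local_hideal idI); exists d, F, G; split=> //; apply: JI.
Qed.

(** Primality is shown as in Gauss's lemma, with the lowest coefficients outside [I]. The ideal is
    relevant because [X_a] has the coefficient za / za = 1. *)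
Lemma homog_prime_of I : prime_ideal A I ->
  exists E : homog_prime k N, forall F, E F <-> hideal I F.
Proof.
move=> prI; have idI := prime_ideal_ideal prI.
have [_ h0 hD hM] := ideal_hideal idI.
have h_homog d F : hideal I F -> hideal I (pihomog mdeg d F).
  by move=> IF; apply/(hideal_homog idI (pihomogP _ _ _)); rewrite -coef_dehom.
have h_prime F G : hideal I (F * G) -> hideal I F \/ hideal I G.
  move=> IFG; apply: NNPP => /not_or_and [nF nG].
  have min (p : {poly K}) : ~ (forall d, I p`_d) ->
      exists2 d, ~ I p`_d & forall e, (e < d)%N -> I p`_e.
    move=> np; apply: NNPP => nex; apply: np => d.
    elim/ltn_ind: d => d IHd; apply: NNPP => nId; apply: nex.
    by exists d.
  have [d nFd ltF] := min _ nF; have [e nGe ltG] := min _ nG.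
  have := IFG (d + e)%N; rewrite /dehom rmorphM /= -/(dehom F) -/(dehom G) coefM.
  have lt_d : (d < (d + e).+1)%N by rewrite ltnS leq_addr.
  rewrite (bigD1 (Ordinal lt_d)) //= addKn => Isum.
  (* Every other term of the coefficient of degree d + e has a factor of index below [d] or below
     [e], hence in [I]. *)
  have : I ((dehom F)`_d * (dehom G)`_e).
    rewrite -[_ * _](addrK (\sum_(i < (d + e).+1 | i != Ordinal lt_d)
      (dehom F)`_i * (dehom G)`_(d + e - i))).
    apply: (idealB local_ring1 local_ringB idI) => //.
    apply: ideal_sum => // i ne_id.
    have [lt_id|le_di] := ltnP i d.
      by rewrite mulrC; apply: (idealM idI); [exact: local_ring_dehom | exact: ltF].
    apply: (idealM idI); first exact: local_ring_dehom.
    apply: ltG; rewrite ltn_subLR; last by rewrite -ltnS.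
    rewrite ltn_add2r ltn_neqAle le_di andbT; apply/eqP => e'.
    by case/eqP: ne_id; apply: val_inj.
  by case/(prime_idealM prI (local_ring_dehom _ _) (local_ring_dehom _ _)).
have h_rel : exists i, ~ hideal I 'X_i.
  exists a => /(hideal_homog idI (homogX a)).
  by rewrite mmapX mmap1U expr1 divff ?za_neq0 //; exact: prime_ideal1 prI.
exists (HomogPrime h0 hD (fun F G => hM F G Logic.I) h_homog h_prime h_rel).
by move=> F; split.
Qed.


Lemma vanish_hideal F : hideal M F -> vanish P F.
Proof.
move=> MF; rewrite (pihomog_partitionE (leqnn (mmeasure mdeg F))) /vanish raddf_sum big1 //.
move=> d _; have := MF d; rewrite coef_dehom -gen_Xn.
by move/(mem_local_ideal prime_at_vanish (pihomogP _ _ _) (homogXn a d) (@vanish_Xn d)).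
Qed.

Let idM : ideal A M := local_ideal_ideal prime_at_vanish.
Let AM (f g : K) : A f -> A g -> A (f * g). Proof. exact: local_ringM vanishM. Qed.
Let M1 : ~ M 1. Proof. exact: prime_ideal1 (prime_local_ideal prime_at_vanish). Qed.
Let AV (f : K) : A f -> ~ M f -> A f^-1. Proof. exact: local_ringV. Qed.

(** The zero set of [I] is a proper subset of X because [I] is non-zero, and strictly contains the
    point P because [I] is not [M]; in a surface this leaves dimension 1. *)
Lemma curve_of_prime_ideal I : has_dim X 2 -> prime_ideal A I ->
  (exists2 f, I f & f != 0) -> ~ (forall f, M f -> I f) ->
  exists E : curve X, lies_on P E /\ forall f, local_ideal (vanish P) E f <-> I f.
Proof.
move=> [dimX _] prI [f If f_neq0] nMI.
have idI := prime_ideal_ideal prI.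
have IM := prime_sub_max idM AV prI.
have [E EI] := homog_prime_of prI.
(* [W] is the point P as an irreducible closed subset. *)
have [W WM] := homog_prime_of (prime_local_ideal prime_at_vanish).
have EX : closed_sub E X.
  move=> F XF; apply/EI => d; rewrite coef_dehom.
  have -> : (pihomog mdeg d F)^gen = 0.
    by apply/(gen_coordP _ (pihomogP _ _ _)); apply: in_ideal_homog.
  by rewrite mul0r; apply: ideal0 idI.
have PE : lies_on P E.
  by move=> F /EI IF; apply: vanish_hideal => d; apply: IM.
have EI_local g : local_ideal (vanish P) E g <-> I g.
  rewrite -(local_hideal idI); split=> -[d [F [G [hF hG /EI IF nG ->]]]];
  by exists d, F, G.
have nXE : ~ closed_sub X E.
  move=> XE; case/EI_local: If => d [F [G [hF hG /XE XF nG deff]]].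
  by move/eqP: f_neq0; apply; rewrite deff (proj2 (gen_coordP _ hF) XF) mul0r.
suff dimE : has_dim E 1 by exists (Curve EX dimE).
split; first exact: dimX EX nXE.
case=> // _ /(_ W) dim0; apply: dim0 => [F /EI IF|EW].
  by apply/WM => d; apply: IM.
apply: nMI => g /(local_hideal idM) [d [F [G [hF hG MF nG ->]]]].
apply/EI_local; exists d, F, G; split=> //; exact/EW/WM.
Qed.

Lemma funfield_frac (f : K) : exists u v, [/\ A u, A v, v != 0 & f = u / v].
Proof.
have [d [F [G [hF hG nXG ->]]]] := funfieldP f.
have nz : za ^+ d != 0 by rewrite expf_neq0 ?za_neq0.
have nzG : G^gen != 0 by apply/eqP => /(gen_coordP _ hG).
exists (F^gen / ('X_a ^+ d)^gen), (G^gen / ('X_a ^+ d)^gen).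
split; rewrite ?gen_Xn; first 2 last.
- by rewrite mulf_neq0 ?invr_eq0.
- by field; apply/andP.
- by rewrite -gen_Xn; apply: local_ring_mk (homogXn a d) (@vanish_Xn d).
- by rewrite -gen_Xn; apply: local_ring_mk (homogXn a d) (@vanish_Xn d).
Qed.

(** * The local ring along a curve through P *)

Section LocalRingAtCurve.
Variable E : homog_prime k N.
Hypotheses (EX : closed_sub E X) (PE : lies_on P E).
Local Notation IE := (@local_ideal _ _ X (vanish P) E).
Local Notation RE := (@local_ring _ _ X E).
Let prE := prime_at_closed EX PE.
Let idE : ideal A IE := local_ideal_ideal prE.

(** The local ring at [E] is the localization of the one at P at the prime of [E]: dividing by X_a^d
    turns forms into elements of [A]. Taking [J] to be everything gives the ring, and [E] its
    maximal ideal. *)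
Lemma localization (J : S -> Prop) f : (forall F G, J F -> J (F * G)) ->
  local_ideal E J f <->
  exists u v, [/\ local_ideal (vanish P) J u, A v, ~ IE v & f = u / v].
Proof.
move=> JM; split=> [[d [F [G [hF hG JF nG ->]]]]|].
  have nz : za ^+ d != 0 by rewrite expf_neq0 ?za_neq0.
  have nzG : G^gen != 0 by apply/eqP => /(gen_coordP _ hG) /EX.
  exists (F^gen / ('X_a ^+ d)^gen), (G^gen / ('X_a ^+ d)^gen).
  have nX := @vanish_Xn d; have hX := homogXn a d.
  split; first by exists d, F, ('X_a ^+ d).
  - exact: local_ring_mk hG hX nX.
  - by move/(mem_local_ideal prE hG hX nX).
  - by rewrite gen_Xn; field; apply/andP.
move=> [_ [_ [[d [F [G [hF hG JF nG ->]]]] [e [F' [G' [hF' hG' _ nG' ->]]]] nI ->]]].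
exists (d + e)%N, (F * G'), (G * F'); split; try exact: dhomogM.
- exact: JM.
- case/(prime_at_prime prE) => [/(prime_at_sub prE)//|EF']; apply: nI.
  by exists e, F', G'.
by rewrite invf_div mulf_div !rmorphM.
Qed.

Lemma local_ring_curveP f : RE f <-> exists u v, [/\ A u, A v, ~ IE v & f = u / v].
Proof. exact: localization. Qed.

Lemma local_max_curveP f : local_max E f <->
  exists u v, [/\ IE u, A v, ~ IE v & f = u / v].
Proof. by apply: localization => F G EF; rewrite mulrC; apply: in_idealM. Qed.

Lemma local_ring_curve_sub f : A f -> RE f.
Proof.
move=> Af; apply/local_ring_curveP; exists f, 1; split=> //; first exact: local_ring1.
  exact: prime_ideal1 (prime_local_ideal prE).
by rewrite divr1.
Qed.

Lemma local_ring_curveM f g : RE f -> RE g -> RE (f * g).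
Proof. by apply: local_ringM => F G; apply: in_ideal_prime. Qed.

Lemma local_max_frac u v : A u -> A v -> ~ IE u -> ~ IE v -> ~ local_max E (u / v).
Proof.
move=> Au Av nu nv /local_max_curveP [u1 [v1 [Iu1 Av1 nv1 e]]].
have neq0 w : ~ IE w -> w != 0 by move=> nw; apply/eqP => w0; apply: nw; rewrite w0; apply: ideal0 idE.
have : IE (u * v1).
  have -> : u * v1 = v * u1.
    by apply/eqP; rewrite [v * _]mulrC -eqr_div ?neq0 // e.
  exact: (idealM idE).
by case/(prime_idealM (prime_local_ideal prE)).
Qed.

Lemma local_ring_curveV u : A u -> ~ IE u -> RE u^-1.
Proof.
move=> Au nu; apply: local_ringV; first exact: local_ring_curve_sub.
have := local_max_frac Au local_ring1 nu (prime_ideal1 (prime_local_ideal prE)).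
by rewrite divr1.
Qed.

Lemma local_ring_curveXz b (n : int) : RE b -> RE b^-1 -> RE (b ^ n).
Proof.
have RX c i : RE c -> RE (c ^+ i).
  move=> Rc; elim: i => [|i IHi]; last by rewrite exprS; apply: local_ring_curveM.
  by rewrite expr0; apply: local_ring_curve_sub; exact: local_ring1.
by case: n => n Rb RV; [apply: RX | rewrite /exprz -exprVn; apply: RX].
Qed.

End LocalRingAtCurve.

(** * Orders along a curve with a given equation at P *)

Section CurveThroughPoint.
Variables (E : curve X) (p : K).
Hypotheses (PE : lies_on P E) (p_eq : defines_near E P p) (p_neq0 : p != 0).
Local Notation IE := (@local_ideal _ _ X (vanish P) E).
Local Notation RE := (@local_ring _ _ X E).
Let EX := @curve_sub _ _ _ E.
Let prE := prime_at_closed EX PE.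

(** This links [defines_near], a condition at P, with the generators used by [has_ord]. *)
Lemma local_generator_curve : local_generator E E p.
Proof.
move=> f; split.
  case/(local_max_curveP EX PE) => u [v [/p_eq [b Ab ->] Av nv ->]].
  exists (b / v); last by rewrite mulrAC.
  by apply/(local_ring_curveP EX PE); exists b, v.
case=> b /(local_ring_curveP EX PE) [u [v [Au Av nv ->]]] ->.
apply/(local_max_curveP EX PE); exists (u * p), v; split=> //; last by rewrite mulrAC.
by apply/p_eq; exists u.
Qed.

(** The order is the difference of the powers of [p] split off numerator and denominator. *)
Lemma has_ord_exists f : f != 0 -> exists n, has_ord E f n.
Proof.
have [u [v [Au Av v_neq0 ->]]] := funfield_frac f => f_neq0.
have u_neq0 : u != 0 by apply: contraNneq f_neq0 => ->; rewrite mul0r.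
have decomp := principal_prime_decomp local_ring1 local_ringB AM noetherian_local_ring
  idM M1 AV (prime_local_ideal prE) p_eq.
have [n [u' [Au' nu' ->]]] := decomp u Au u_neq0.
have [m [v' [Av' nv' ->]]] := decomp v Av v_neq0.
exists (n%:Z - m%:Z), p, (u' / v'); split.
- exact: local_generator_curve.
- by apply/(local_ring_curveP EX PE); exists u', v'.
- exact: local_max_frac.
- by rewrite expfzDr // -invr_expz -!exprnP invfM mulrACA.
Qed.

(** The generator [t] supplied with the order may differ from [p], but each divides the other, so t
    = b p with a unit b, which only changes the unit factor of [f]. *)
Lemma ord_unit f : f != 0 -> RE (f / p ^ ord E f) /\ RE (f / p ^ ord E f)^-1.
Proof.
move=> f_neq0; have := epsilon_spec (inhabits 0) _ (has_ord_exists f_neq0).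
rewrite -/(ord E f) => -[t [w [gen_t Rw nMw deff]]].
have nIE1 := prime_ideal1 (prime_local_ideal prE).
have RE1 : RE 1 := local_ring_curve_sub EX PE local_ring1.
have [b Rb deft] : exists2 b, RE b & t = b * p.
  by apply/local_generator_curve/gen_t; exists 1; rewrite ?mul1r.
have [c Rc defp] : exists2 c, RE c & p = c * t.
  by apply/gen_t/local_generator_curve; exists 1; rewrite ?mul1r.
have cb1 : c * b = 1.
  by apply: (mulIf p_neq0); rewrite mul1r -mulrA -deft.
have b_neq0 : b != 0 by apply/eqP => b0; move/eqP: cb1; rewrite b0 mulr0 eq_sym oner_eq0.
have Vb : b^-1 = c by rewrite -[LHS]mul1r -cb1 mulfK.
have -> : f / p ^ ord E f = b ^ ord E f * w.
  by rewrite {1}deff deft expfzMl mulrAC mulfK // expfz_neq0.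
split; first by apply: local_ring_curveM => //; apply: (local_ring_curveXz EX PE); rewrite ?Vb.
rewrite invfM expfV; apply: local_ring_curveM; last exact: local_ringV.
by apply: (local_ring_curveXz EX PE); rewrite ?invrK ?Vb.
Qed.

End CurveThroughPoint.

(** * Non-vanishing of g at P *)

(** A strict inclusion in the one-dimensional [D] would make [C] of dimension 0. *)
Lemma curve_sub_eq (C D : curve X) : closed_sub C D -> closed_eq C D.
Proof.
move=> CD; split=> //; apply: NNPP => nDC.
have [dimD _] := @curve_dim _ _ _ D; have [_ ndimC] := @curve_dim _ _ _ C.
exact: (ndimC 0%N) _ (dimD C CD nDC).
Qed.

(** If [x] were in the ideal of [E], so would be all its multiples, hence all forms vanishing on
    [C]; then [E] would lie in [C] and equal it. *)
Lemma nmem_local_ideal (E C : curve X) x : lies_on P E -> lies_on P C ->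
  defines_near C P x -> ~ closed_eq E C -> ~ local_ideal (vanish P) E x.
Proof.
move=> PE PC x_eq nEC Ex; apply/nEC/curve_sub_eq => F CF.
have prE := prime_at_closed (@curve_sub _ _ _ E) PE.
rewrite (pihomog_partitionE (leqnn (mmeasure mdeg F))).
elim/big_ind: _ => [||d _]; [exact: in_ideal0 | exact: in_idealD |].
have hF := pihomogP mdeg d F; have hX := homogXn a d; have nX := @vanish_Xn d.
apply/(mem_local_ideal prE hF hX nX).
have /x_eq [b Ab ->] : local_ideal (vanish P) C ((pihomog mdeg d F)^gen / ('X_a ^+ d)^gen).
  by exists (d : nat), (pihomog mdeg d F), ('X_a ^+ d); split=> //; apply: in_ideal_homog.
exact: idealM (local_ideal_ideal prE) _ _ Ab Ex.
Qed.

(** A zero value would put [g] in [M], and with it 1. *)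
Lemma value_neq0 g : g != 0 -> A g -> A g^-1 -> value g P != 0.
Proof.
move=> g_neq0 Ag AVg; apply/eqP => val0.
have [|d [F [G [hF hG nG defg]]]] := epsilon_spec (inhabits 0) (has_value g P).
  have [d [F [G [hF hG _ nG ->]]]] := Ag.
  by exists (F.@[P] / G.@[P]), d, F, G.
rewrite -/(value g P) val0 => /esym/eqP; rewrite mulf_eq0 invr_eq0 => /orP[]/eqP //.
move=> PF; apply: M1.
have Mg : M g by exists d, F, G.
by rewrite -(mulVf g_neq0); apply: (idealM idM).
Qed.

Lemma gval_neq0 (C D : curve X) (x y f : K) : has_dim X 2 -> ~ closed_eq C D ->
  lies_on P C -> lies_on P D -> defines_near C P x -> defines_near D P y ->
  Defs.transversal C D P -> f != 0 ->
  (forall E : curve X, lies_on P E -> ~ closed_eq E C -> ~ closed_eq E D -> ord E f = 0) ->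
  gval C D x y P f != 0.
Proof.
move=> dimX nCD PC PD x_eq y_eq trans f_neq0 ord0.
have nDC : ~ closed_eq D C by move=> [DC CD]; apply: nCD.
have CX := @curve_sub _ _ _ C; have DX := @curve_sub _ _ _ D.
have prC := prime_at_closed CX PC; have prD := prime_at_closed DX PD.
have nCy := nmem_local_ideal PC PD y_eq nCD.
have nDx := nmem_local_ideal PD PC x_eq nDC.
have x_neq0 : x != 0.
  by apply/eqP => x0; apply: nDx; rewrite x0; apply: ideal0 (local_ideal_ideal prD).
have y_neq0 : y != 0.
  by apply/eqP => y0; apply: nCy; rewrite y0; apply: ideal0 (local_ideal_ideal prC).
have Cx : local_ideal (vanish P) C x by apply/x_eq; exists 1; rewrite ?mul1r //; apply: local_ring1.
have Dy : local_ideal (vanish P) D y by apply/y_eq; exists 1; rewrite ?mul1r //; apply: local_ring1.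
have Ax := ideal_sub (local_ideal_ideal prC) Cx.
have Ay := ideal_sub (local_ideal_ideal prD) Dy.
set m := ord C f; set n := ord D f.
pose h := x ^ m * y ^ n.
have h_neq0 : h != 0 by rewrite mulf_neq0 ?expfz_neq0.
have unitXz (E : curve X) (z : K) (i : int) : lies_on P E -> A z -> ~ local_ideal (vanish P) E z ->
    local_ring E (z ^ i) /\ local_ring E (z ^ i)^-1.
  move=> PE Az nEz; have EX := @curve_sub _ _ _ E.
  have Rz := local_ring_curve_sub EX PE Az; have RV := local_ring_curveV EX PE Az nEz.
  by rewrite expfV; split; apply: (local_ring_curveXz EX PE); rewrite ?invrK.
(* [closed_eq] compares ideals and is not equality of records, so membership in local rings is
   transported by hand. *)
have sub_ring (E C' : curve X) (z : K) : closed_eq E C' -> local_ring C' z -> local_ring E z.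
  by move=> [_ C'E] [d [F [G [hF hG _ nG ->]]]]; exists d, F, G; split=> // /C'E.
(* Along [C] the factor f / x^m is a unit, and so is [y]; along [D] the roles are exchanged; along
   any other curve [x], [y] and, having order 0, [f] are all units. *)
have unit (E : curve X) p : lies_on P E -> defines_near E P p -> p != 0 ->
    local_ring E (f / h) /\ local_ring E (f / h)^-1.
  move=> PE p_eq p_neq0; have EX := @curve_sub _ _ _ E.
  have RM := @local_ring_curveM E.
  have [EC|nEC] := classic (closed_eq E C).
    have [Rf RVf] := ord_unit PC x_eq x_neq0 f_neq0.
    have [Ry RVy] := unitXz C y n PC Ay nCy.
    have -> : f / h = f / x ^ m * (y ^ n)^-1 by rewrite /h invfM mulrA.
    by rewrite (invfM (f / _)) invrK; split; apply: (sub_ring _ _ _ EC); apply: local_ring_curveM.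
  have [Rx RVx] := unitXz E x m PE Ax (nmem_local_ideal PE PC x_eq nEC).
  have [ED|nED] := classic (closed_eq E D).
    have [Rf RVf] := ord_unit PD y_eq y_neq0 f_neq0.
    have -> : f / h = f / y ^ n * (x ^ m)^-1 by rewrite /h [x ^ m * _]mulrC invfM mulrA.
    rewrite (invfM (f / _)) invrK; split; apply: RM => //; exact: (sub_ring _ _ _ ED).
  have [Ry RVy] := unitXz E y n PE Ay (nmem_local_ideal PE PD y_eq nED).
  have [] := ord_unit PE p_eq p_neq0 f_neq0.
  rewrite (ord0 E PE nEC nED) expr0z divr1 => Rf RVf.
  have [Rh RVh] : local_ring E h /\ local_ring E h^-1.
    by rewrite /h invfM; split; apply: RM.
  by rewrite (invfM f) invrK; split; apply: RM.
have Mxy g : M g -> exists a b, [/\ A a, A b & g = a * x + b * y].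
  move=> /trans [_ [_ [/x_eq [b Ab ->] /y_eq [c Ac ->] ->]]].
  by exists b, c.
have subM (W : curve X) z : lies_on P W -> local_ideal (vanish P) W z -> M z.
  by move=> PW [d [F [G [hF hG WF nG ->]]]]; exists d, F, G; split=> //; apply: PW.
have Mx := subM C x PC Cx; have My := subM D y PD Dy.
have prx := eq_prime_ideal x_eq (prime_local_ideal prC).
have nxy : ~ exists2 b, A b & y = b * x by move/x_eq.
have codim1 I : prime_ideal A I -> (exists2 z, I z & z != 0) -> ~ (forall z, M z -> I z) ->
    (exists u v, [/\ A u, A v, ~ I v & f / h = u / v]) /\
    (exists u v, [/\ A u, A v, ~ I v & (f / h)^-1 = u / v]).
  move=> prI nzI nMI.
  (* The generator [p] of [I] becomes the equation at P of the curve [E] cut out by [I]. *)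
  have [p Ip] := prime_principal local_ring1 local_ringB AM noetherian_local_ring
    idM M1 AV Mx My Mxy prI nzI nMI.
  have [E [PE EI]] := curve_of_prime_ideal dimX prI nzI nMI.
  have p_neq0 : p != 0.
    by apply/eqP => p0; case: nzI => z /Ip[b _ ->]; rewrite p0 mulr0 eqxx.
  have p_eq : defines_near E P p by move=> z; rewrite EI.
  have [] := unit E p PE p_eq p_neq0.
  move=> /(local_ring_curveP (@curve_sub _ _ _ E) PE) [u [v [Au Av nv ->]]].
  move=> /(local_ring_curveP (@curve_sub _ _ _ E) PE) [u' [v' [Au' Av' nv' ->]]].
  by split; [exists u, v | exists u', v']; split=> //; rewrite -EI.
have frac z : exists u v, [/\ A u, A v & z = u / v].
  by have [u [v [Au Av _ ->]]] := funfield_frac z; exists u, v.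
have regular := regular_in_codim1 local_ring1 local_ringB AM noetherian_local_ring idM
  x_neq0 Mx My prx nxy.
rewrite /gval -/m -/n -/h; apply: value_neq0; first by rewrite mulf_neq0 ?invr_eq0.
  by apply: regular => // I prI nzI nMI; case: (codim1 I prI nzI nMI).
by apply: regular => // I prI nzI nMI; case: (codim1 I prI nzI nMI).
Qed.

End LocalRingAtPoint.

(** On the right [g1] has exponent n3 m2 from the first factor and -n2 m3 from the second, which add
    up to D1; [g2] and [g3] follow cyclically. Non-zero bases allow powers with integer exponents to
    be split. *)
Lemma parshin_refined_identity (F : fieldType) (m1 m2 m3 n1 n2 n3 : int) (g1 g2 g3 : F) :
  g1 != 0 -> g2 != 0 -> g3 != 0 ->
  (-1) ^ (n1 * n2 * m3 + n2 * n3 * m1 + n3 * n1 * m2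
          - m1 * m2 * n3 - m2 * m3 * n1 - m3 * m1 * n2)
  * g1 ^ (m2 * n3 - m3 * n2) * g2 ^ (m3 * n1 - m1 * n3) * g3 ^ (m1 * n2 - m2 * n1) =
  (-1) ^ (n1 * n3 * m2 - m1 * m3 * n2) * (g1 ^ n3 / g3 ^ n1) ^ m2
  * ((-1) ^ (n2 * n1 * m3 - m2 * m1 * n3) * (g2 ^ n1 / g1 ^ n2) ^ m3)
  * ((-1) ^ (n3 * n2 * m1 - m3 * m2 * n1) * (g3 ^ n2 / g2 ^ n3) ^ m1).
Proof.
move=> g1_neq0 g2_neq0 g3_neq0.
have quot (u v : F) (p q m : int) :
    (u ^ p / v ^ q) ^ m = u ^ (p * m) / v ^ (q * m).
  by rewrite expfzMl -expfV -!exprz_exp.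
have neq0 (u : F) (p : int) : u != 0 -> u ^ p != 0 by move=> ?; rewrite expfz_neq0.
have N1_neq0 : (-1 : F) != 0 by rewrite oppr_eq0 oner_eq0.
rewrite !quot.
have -> : n1 * n2 * m3 + n2 * n3 * m1 + n3 * n1 * m2 - m1 * m2 * n3 - m2 * m3 * n1 - m3 * m1 * n2
    = (n1 * n3 * m2 - m1 * m3 * n2) + (n2 * n1 * m3 - m2 * m1 * n3)
      + (n3 * n2 * m1 - m3 * m2 * n1) by ring.
rewrite 2!(expfzDr _ _ N1_neq0).
rewrite !(expfzDr _ _ g1_neq0, expfzDr _ _ g2_neq0, expfzDr _ _ g3_neq0) -!invr_expz.
(* With the exponents in one order, [field] meets the same powers on both sides and treats them as
   atoms. *)
rewrite [m2 * n3]mulrC [m3 * n2]mulrC [m3 * n1]mulrC [m1 * n3]mulrC [m1 * n2]mulrC [m2 * n1]mulrC.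
by field; rewrite !neq0.
Qed.

Theorem theorem0p2 (R : realType) (N : nat) (X : variety R[i] N)
  (smoothX : smooth_surface X)
  (f1 f2 f3 : funfield X) (f1_neq0 : f1 != 0) (f2_neq0 : f2 != 0)
  (f3_neq0 : f3 != 0)
  (r : nat) (C : 'I_r.+1 -> curve X)
  (compC : divisor_components f1 f2 f3 C)
  (nonsingC : forall i, nonsingular (C i))
  (crossC : normal_crossings C)
  (x : 'I_r.+1 -> funfield X)
  (ordx : forall i j, ord (C j) (x i) = (i == j)%:R)
  (j : 'I_r.+1) (j_neq0 : j != ord0)
  (P : point R[i] N) (PC0 : lies_on P (C ord0)) (PCj : lies_on P (C j))
  (x0_eq : defines_near (C ord0) P (x ord0))
  (xj_eq : defines_near (C j) P (x j)) :
  parshin_symbol (C ord0) (C j) (x ord0) (x j) P f1 f2 f3 =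
    refined_symbol (C ord0) (C j) (x ord0) (x j) P f1 f2 f3
    * refined_symbol (C ord0) (C j) (x ord0) (x j) P f2 f3 f1
    * refined_symbol (C ord0) (C j) (x ord0) (x j) P f3 f1 f2.
Proof.
have nC0j : ~ closed_eq (C ord0) (C j).
  by move/compC.1 => e; rewrite -e eqxx in j_neq0.
have [i Pi] := coords_neq0 P.
have PX : lies_on P X by move=> F /(@curve_sub _ _ _ (C ord0)) /PC0.
have ne0j : ord0 != j by rewrite eq_sym.
have trans := crossC.2 ord0 j P ne0j PC0 PCj.
have gval_f f : f != 0 -> (forall E, ord E f != 0 -> exists i, closed_eq E (C i)) ->
    gval (C ord0) (C j) (x ord0) (x j) P f != 0.
  move=> f_neq0 compf; apply: (gval_neq0 Pi PX smoothX.1) => // E PE nE0 nEj.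
  (* A further curve through P with non-zero order would be a third component at P, against normal
     crossings. *)
  apply/eqP; apply: contraT => /compf [l El].
  have PCl : lies_on P (C l) by move=> F /El.1 /PE.
  have l_neq0 : l != ord0 by apply/eqP => e; apply: nE0; rewrite -e.
  have l_neqj : l != j by apply/eqP => e; apply: nEj; rewrite -e.
  by case: (crossC.1 ord0 j l P); rewrite // eq_sym.
rewrite /parshin_symbol /refined_symbol /=; apply: parshin_refined_identity.
- by apply: gval_f => // E ordE; apply/compC.2; constructor 1.
- by apply: gval_f => // E ordE; apply/compC.2; constructor 2.
- by apply: gval_f => // E ordE; apply/compC.2; constructor 3.
Qed.
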